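(* Let $m\ge 1$, let $T_1, T_2, \ldots, T_m$ be finite rooted trees, and let $T' = \mathrm{RootedTree}(v, T_1, T_2, \ldots, T_m)$. Then $$R_{T'}(v) = \mathrm{lcm}\bigl(P(T_1), P(T_2), \ldots, P(T_m)\bigr),$$ and for each $k\in\{1,\ldots,m\}$ and each vertex $w$ in $T_k$, $$R_{T'}(w) = \frac{R_{T'}(v)}{P(T_k)}\, R_{T_k}(w).$$ Here $R_T$ denotes the restoration function and $P(T)$ the period of a rooted tree $T$.
   Context: All trees are finite. For a vertex $r$ and rooted trees $T_1,\ldots,T_m$ on disjoint vertex sets not containing $r$, $\mathrm{RootedTree}(r,T_1,\ldots,T_m)$ denotes the rooted tree with root $r$ whose subtrees at the children of $r$ are $T_1,\ldots,T_m$ (i.e. $r$ is joined by an edge to the root of each $T_i$). Stochastic abacus on a rooted tree $T$ with root $r$ and vertex set $V_T$. Form the augmented directed graph: replace every edge of $T$ by two directed edges (one in each direction), and for each $v\in V_T$ add a new absorbing vertex $v^*$ together with a directed edge $v\to v^*$. Thus the outdegree of $v\in V_T$ is $\deg_T(v)+1$, and absorbing vertices have no outgoing edges. A state assigns a nonnegative integer number of chips to each vertex. A vertex $v\in V_T$ holding at least $\deg_T(v)+1$ chips may fire: it loses $\deg_T(v)+1$ chips and sends one chip along each of its outgoing edges. Absorbing vertices never fire and only accumulate chips. The critical loading is the state in which each $v\in V_T$ holds exactly $\deg_T(v)$ chips (one less than its outdegree). The abacus starts from the critical loading with all absorbing vertices empty; chips are added one at a time to the root $r$, and after each addition vertices of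 $V_T$ are fired, in any order, until none can fire. The process stops the first time, after at least one chip has been added, that no vertex can fire and every $v \in V_T$ again holds exactly $\deg_T(v)$ chips (return to critical loading). The restoration number $R(T)$ is the number of times the root fires during this process; equivalently, the number of chips in the root's absorbing vertex upon return to critical loading. The restoration function $R_T$ is the function on $V_T$ for which $R_T(v)$ is the number of chips in $v$'s absorbing vertex $v^*$ upon return to critical loading (so $R_T(r)=R(T)$). The period $P(T)$ of a rooted tree $T$ is the restoration number of the rooted tree having $T$ as its only subtree: $P(T)=R(\mathrm{RootedTree}(u,T))=R_{\mathrm{RootedTree}(u,T)}(u)$, where $u$ is a new vertex. *)

(* Defs.v *)
From Stdlib Require Import Relation_Operators ClassicalEpsilon.
From mathcomp Require Import all_boot zify.

Set Implicit Arguments.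
Unset Strict Implicit.
Unset Printing Implicit Defensive.

Record rooted_tree : Type := MkRootedTree {
  vert :> finType;
  tree_edge : rel vert;
  tree_root : vert;
  tree_edge_sym : symmetric tree_edge;
  tree_edge_irr : irreflexive tree_edge;
  tree_edge_connected : forall x y, connect tree_edge x y;
  (* for a symmetric relation, an edge walked back and forth is a cycle of
     size 2, so only longer simple cycles are excluded *)
  tree_edge_acyclic : forall c : seq vert, ucycle tree_edge c -> size c <= 2 }.

Arguments tree_edge {r} x y.
Arguments tree_root r : clear implicits.

Section Join.

Variables (m : nat) (T : 'I_m -> rooted_tree).

Definition join_vert : finType := option {i : 'I_m & vert (T i)}.

(* [None] is the new root; [Some (Tagged _ x)] with [x : T i] is the copy of [x]
   in the [i]-th summand of the disjoint union *)
Definition join_edge : rel join_vert := fun x y =>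
  match x, y with
  | None, None => false
  | None, Some w => tagged w == tree_root (T (tag w))
  | Some w, None => tagged w == tree_root (T (tag w))
  | Some w, Some w' => (tag w == tag w') && tree_edge (tagged w) (tagged_as w w')
  end.

Definition in_join (i : 'I_m) (x : T i) : join_vert :=
  Some (Tagged (fun i => vert (T i)) x).

Lemma join_edgeE i (x y : T i) : join_edge (in_join x) (in_join y) = tree_edge x y.
Proof. by rewrite /join_edge /= eqxx tagged_asE. Qed.

Lemma in_join_inj i : injective (@in_join i).
Proof. by move=> x y [] /eqP; rewrite -tag_eqE /tag_eq eqxx tagged_asE => /eqP. Qed.

Lemma join_edge_sym : symmetric join_edge.
Proof.
move=> [[i x]|] [[j y]|] //=; case: (eqVneq i j) => [eij|//] /=.
by case: j / eij y => y; rewrite !tagged_asE tree_edge_sym.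
Qed.

Lemma join_edge_irr : irreflexive join_edge.
Proof. by move=> [[i x]|] //=; rewrite eqxx tagged_asE tree_edge_irr. Qed.

Lemma connect_in_join i (x y : T i) :
  connect join_edge (in_join x) (in_join y).
Proof.
have /connectP[p] := tree_edge_connected x y.
elim: p x => [|z p IHp] x /= => [_ -> //|/andP[exz pz] ey].
by apply: connect_trans (IHp z pz ey); apply: connect1; rewrite join_edgeE.
Qed.

Lemma join_edge_connected x y : connect join_edge x y.
Proof.
have csym : connect_sym join_edge by apply/sym_connect_sym/join_edge_sym.
suff cN z : connect join_edge None z.
  by apply: connect_trans (cN y); rewrite csym.
case: z => [[i z]|] //; apply: connect_trans (connect_in_join (tree_root (T i)) z).
by apply: connect1; rewrite /join_edge /=.
Qed.

Lemma join_path i (x : T i) p :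
    path join_edge (in_join x) p -> None \notin p ->
  exists2 q, p = map (@in_join i) q & path tree_edge x q.
Proof.
elim: p x => [|z p IHp] x; first by exists [::].
rewrite in_cons negb_or => /= /andP[exz pz] /andP[zN pN].
case: z => [[j z]|] // in exz pz zN *.
move: (exz) => /andP[/eqP/= eij _]; case: j / eij z => z in exz pz zN *.
have [q -> qz] := IHp z pz pN; exists (z :: q) => //=.
by rewrite qz andbT -join_edgeE.
Qed.

Lemma join_edge_acyclic (c : seq join_vert) : ucycle join_edge c -> size c <= 2.
Proof.
have [Nc|Nc] := boolP (None \in c).
  have [k c' Ec] := rot_to Nc.
  rewrite -(rot_ucycle k) -(size_rot k) Ec => /andP[cc' /= /andP[Nc' uc']].
  case: c' => [//|[[i x]|//] p] /= in Ec cc' Nc' uc' *.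
  have /andP[/eqP xr] := cc'; rewrite rcons_path => /andP[px plast].
  have [||q Ep _] := @join_path i x p; [exact: px| |].
    by move: Nc'; rewrite in_cons negb_or => /andP[].
  rewrite {}Ep size_map in px plast Nc' uc' *.
  case/lastP: q => [//|q y] in px plast Nc' uc' *.
  move: plast uc'; rewrite map_rcons last_rcons /= mem_rcons in_cons.
  by move=> /eqP ->; rewrite xr eqxx.
case: c Nc => [//|[[i x]|//] p] Nc /andP[/= pc up].
have [||q Ep pq] := @join_path i x (rcons p (in_join x)); [exact: pc| |].
  by rewrite mem_rcons.
case/lastP: q Ep pq => [|q y]; first by case: (p).
rewrite map_rcons => /rcons_inj E pq.
have /= Ep := congr1 fst E; have /= /in_join_inj exy := congr1 snd E.
subst y.
have /= := @tree_edge_acyclic (T i) (x :: q); rewrite Ep size_map; apply.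
rewrite /ucycle /= pq /=.
have : uniq (map (@in_join i) (x :: q)) by rewrite /= -Ep.
exact: map_uniq.
Qed.

Definition root_join : rooted_tree :=
  @MkRootedTree join_vert join_edge None join_edge_sym join_edge_irr
    join_edge_connected join_edge_acyclic.

End Join.

Section Abacus.

Variable T : rooted_tree.

(* [inl v] is the vertex [v], [inr v] the absorbing vertex of [v] *)
Definition aug_vert : finType := (vert T + vert T)%type.

Definition aug_arc : rel aug_vert := fun x y =>
  match x, y with
  | inl v, inl w => tree_edge v w
  | inl v, inr w => v == w
  | inr _, _ => false
  end.

Definition deg (v : T) : nat := #|[set w | tree_edge v w]|.

Definition state : Type := {ffun aug_vert -> nat}.

Definition can_fire (s : state) (v : T) : bool := deg v + 1 <= s (inl v).

Definition fire (s : state) (v : T) : state :=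
  [ffun x => s x - (if x == inl v then deg v + 1 else 0) + aug_arc (inl v) x].

Definition fires (s t : state) : Prop :=
  exists2 v, can_fire s v & t = fire s v.

Definition stable (s : state) : Prop := forall v, ~~ can_fire s v.

Definition stabilizes (s t : state) : Prop :=
  clos_refl_trans_1n _ fires s t /\ stable t.

Definition critical (s : state) : Prop := forall v : T, s (inl v) = deg v.

Definition initial : state :=
  [ffun x => match x with inl v => deg v | inr _ => 0 end].

Definition add_chip (s : state) : state := [ffun x => s x + (x == inl (tree_root T))].

(* The stable states reached after each addition of a chip, up to and including
   the first one that is critical *)
Inductive process : state -> Prop :=
| process_first t : stabilizes (add_chip initial) t -> process t
| process_next s t :
    process s -> ~ critical s -> stabilizes (add_chip s) t -> process t.

Definition final (s : state) : Prop := process s /\ critical s.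

Lemma card_aug_arc (v : T) : #|[set x | aug_arc (inl v) x]| = deg v + 1.
Proof.
rewrite -!sum1dep_card big_sumType /=; congr (_ + _).
  by rewrite /deg -sum1dep_card.
by rewrite (eq_bigl (pred1 v)) ?big_pred1_eq // => w; rewrite /= eq_sym.
Qed.

Lemma fireE s v x : fire s v x =
  s x - (if x == inl v then deg v + 1 else 0) + aug_arc (inl v) x.
Proof. exact: ffunE. Qed.

Definition chips (s : state) : nat := \sum_(v : T) s (inl v).

Lemma fire_chips s v : can_fire s v -> chips s = (chips (fire s v)).+1.
Proof.
move=> sv; rewrite /chips.
have Edeg : deg v = \sum_(w : T | w != v) tree_edge v w.
  have: deg v = \sum_(w : T) tree_edge v w.
    by rewrite /deg -sum1dep_card big_mkcond /=; apply: eq_bigr => w; case: tree_edge.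
  by rewrite (bigD1 v) //= tree_edge_irr add0n.
rewrite (bigD1 v) //= [in RHS](bigD1 v) //= ffunE eqxx /= tree_edge_irr.
have -> : \sum_(i | i != v) fire s v (inl i)
        = \sum_(i | i != v) s (inl i) + deg v.
  rewrite Edeg -big_split; apply: eq_bigr => w wv /=; rewrite ffunE.
  by case: eqP => [[ewv]|_]; rewrite ?ewv ?eqxx // in wv *; rewrite subn0.
move: sv; rewrite /can_fire {Edeg} /= addn0.
move: (\sum_(i | i != v) _) (deg v) => A d; move: (s (inl v)) => a; lia.
Qed.

Lemma stabilizes_exists s : exists t, stabilizes s t.
Proof.
have [n] := ubnP (chips s); elim: n s => // n IHn s sn.
case: (pickP (can_fire s)) => [v sv|s0]; last first.
  by exists s; split; [left | move=> v; rewrite s0].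
have [|t [st tS]] := IHn (fire s v).
  by move: sn; rewrite (fire_chips sv).
by exists t; split=> //; right with (fire s v) => //; exists v.
Qed.

Lemma fire_comm s v w : v != w -> can_fire s v -> can_fire s w ->
  can_fire (fire s v) w /\ fire (fire s v) w = fire (fire s w) v.
Proof.
rewrite /can_fire => vw sv sw; split.
  rewrite fireE; case: eqP => [[ewv]|_]; last by lia.
  by rewrite ewv eqxx in vw.
apply/ffunP=> x; rewrite !fireE.
have [->|_] := eqVneq x (inl v); have [xw|_] := eqVneq _ (inl w).
- by case: xw => xw; rewrite xw eqxx in vw.
- have -> : aug_arc (inl v) (inl v) = false by exact: tree_edge_irr.
  by rewrite !subn0 !addn0 addnBAC.
- have -> : aug_arc (inl w) x = false by rewrite xw; exact: tree_edge_irr.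
  by rewrite xw !subn0 !addn0 addnBAC.
- by rewrite !subn0 addnAC.
Qed.

Lemma stabilizes_unique s t t' : stabilizes s t -> stabilizes s t' -> t = t'.
Proof.
have [n] := ubnP (chips s); elim: n s t t' => // n IHn s t t' sn.
move=> [st tS] [st' t'S].
case: st tS => [tS|u {}t [v sv ->] ut tS].
  by case: st' t'S => // u {}t' [v sv _] _ _; move: (tS v); rewrite sv.
case: st' t'S => [t'S|u' {}t' [v' sv' ->] ut' t'S].
  by move: (t'S v); rewrite sv.
have lt_v x : can_fire s x -> chips (fire s x) < n.
  by move=> sx; move: sn; rewrite (fire_chips sx).
have [ev|vv'] := eqVneq v v'.
  by subst v'; apply: (IHn (fire s v)) => //; exact: lt_v.
have [f1 E] := fire_comm vv' sv sv'.
have [|f2 _] := @fire_comm s v' v _ sv' sv; first by rewrite eq_sym.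
have [z [fz zS]] := stabilizes_exists (fire (fire s v) v').
have -> : t = z.
  apply: (IHn (fire s v)) => //; first exact: lt_v.
  by split=> //; right with (fire (fire s v) v') => //; exists v'.
apply: (IHn (fire s v')) => //; first exact: lt_v.
by split=> //; right with (fire (fire s v) v') => //; exists v.
Qed.

Definition stab s : state := proj1_sig (constructive_indefinite_description _ (stabilizes_exists s)).

Lemma stabP s : stabilizes s (stab s).
Proof. exact: proj2_sig (constructive_indefinite_description _ (stabilizes_exists s)). Qed.

Lemma stabE s t : stabilizes s t -> stab s = t.
Proof. by apply: stabilizes_unique; apply: stabP. Qed.

Definition addst (s d : state) : state := [ffun x => s x + d x].

Lemma fires_addst s t d : clos_refl_trans_1n _ fires s t ->
  clos_refl_trans_1n _ fires (addst s d) (addst t d).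
Proof.
elim=> {s t} [s|s t u [v sv ->] _ IH]; first by left.
right with (addst (fire s v) d) => //; exists v.
  by move: sv; rewrite /can_fire ffunE; lia.
apply/ffunP=> x; rewrite !ffunE; move: sv; rewrite /can_fire.
by case: eqP => [->|]; lia.
Qed.

Lemma trans_fires s t u : clos_refl_trans_1n _ fires s t ->
  clos_refl_trans_1n _ fires t u -> clos_refl_trans_1n _ fires s u.
Proof. by elim=> {s t} // s t v st _ IH /IH; right with t. Qed.

Lemma stab_addst s d : stab (addst (stab s) d) = stab (addst s d).
Proof.
have [ss _] := stabP s; have [st tS] := stabP (addst (stab s) d).
by apply/esym/stabE; split=> //; apply: trans_fires st; apply: fires_addst.
Qed.

Definition sim (s t : state) := forall v : T, s (inl v) = t (inl v).

Lemma sim_fires s t s' : clos_refl_trans_1n _ fires s t -> sim s s' ->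
  exists2 t', clos_refl_trans_1n _ fires s' t' & sim t t'.
Proof.
move=> st; elim: st s' => {s t} [s|s t u [v sv ->] _ IH] s' ss'.
  by exists s' => //; left.
have [|t' st' tt'] := IH (fire s' v); first by move=> w; rewrite !ffunE ss'.
exists t' => //; right with (fire s' v) => //; exists v => //.
by rewrite /can_fire -ss'.
Qed.

Lemma sim_stab s s' : sim s s' -> sim (stab s) (stab s').
Proof.
move=> ss'; have [st tS] := stabP s.
have [t' st' tt'] := sim_fires st ss'.
rewrite (@stabE s' t') //; split=> // v; rewrite /can_fire -tt'; exact: tS.
Qed.

Definition rchips n : state := [ffun x => n * (x == inl (tree_root T))].

Definition after n := iter n (fun s => stab (add_chip s)) initial.

Lemma stable_initial : stable initial.
Proof. by move=> v; rewrite /can_fire ffunE addn1 ltnn. Qed.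

Lemma afterE n : after n = stab (addst initial (rchips n)).
Proof.
elim: n => [|n IHn].
  apply/esym/stabE; split; last exact: stable_initial.
  have -> : addst initial (rchips 0) = initial; last by left.
  by apply/ffunP=> x; rewrite !ffunE mul0n addn0.
rewrite /after iterS -/(after n) IHn.
have -> s : add_chip s = addst s (rchips 1).
  by apply/ffunP=> x; rewrite !ffunE mul1n.
rewrite stab_addst; congr stab; apply/ffunP=> x; rewrite !ffunE.
by rewrite -addnA -mulnDl addn1.
Qed.

Lemma after_stable n : stable (after n).
Proof. by rewrite afterE; case: (stabP (addst initial (rchips n))). Qed.

Lemma after_repeat : exists i j, i < j /\ sim (after i) (after j).
Proof.
pose N := \max_(v : T) deg v.
pose F (n : nat) : {ffun T -> 'I_N.+1} := [ffun v => inord (after n (inl v))].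
have leN n v : after n (inl v) <= deg v.
  by have := after_stable n v; rewrite /can_fire; lia.
pose G (k : 'I_(#|{: {ffun T -> 'I_N.+1}}|).+1) := F k.
have /injectivePn[x [y xy Gxy]] : ~~ injectiveb G.
  apply/negP => /injectiveP Ginj; have := leq_card G Ginj.
  by rewrite card_ord ltnn.
have FP i j : F i = F j -> sim (after i) (after j).
  move=> Fij v; have /(congr1 val) := congr1 (fun f : {ffun _} => f v) Fij.
  by rewrite !ffunE /= !inordK // ltnS (leq_trans (leN _ _)) // leq_bigmax.
have [lt_xy|lt_yx|/val_inj exy] := ltngtP x y; last by rewrite exy eqxx in xy.
  by exists x, y; split=> //; exact: FP.
by exists y, x; split=> //; apply: FP.
Qed.

Lemma after_critical : exists n, (0 < n) && [forall v : T, after n (inl v) == deg v].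
Proof.
have [i [j [lt_ij sij]]] := after_repeat.
exists (j - i); rewrite subn_gt0 lt_ij /=; apply/forallP=> v; apply/eqP.
pose d : state := [ffun x => match x with
  inl v => deg v - after i (inl v) | inr _ => 0 end].
have sd : sim initial (addst (after i) d).
  move=> w; rewrite !ffunE; have := after_stable i w; rewrite /can_fire; lia.
have addAC a b c : addst (addst a b) c = addst (addst a c) b.
  by apply/ffunP=> x; rewrite !ffunE addnAC.
rewrite afterE.
have E1 : sim (addst initial (rchips (j - i)))
              (addst (addst (after i) d) (rchips (j - i))).
  by move=> w; rewrite ffunE sd [RHS]ffunE.
have E3 : stab (addst (after i) (rchips (j - i))) = after j.
  rewrite afterE stab_addst afterE; congr stab; apply/ffunP=> x; rewrite !ffunE.
  by rewrite -addnA -mulnDl subnKC // ltnW.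
rewrite (sim_stab E1) addAC -stab_addst E3.
have E2 : sim (addst (after j) d) initial.
  by move=> w; rewrite sd !ffunE sij.
rewrite (sim_stab E2) (@stabE initial initial); last first.
  by split; [left | exact: stable_initial].
by rewrite ffunE.
Qed.

Lemma process_after s : process s <->
  exists n, [/\ 0 < n, s = after n & forall k, 0 < k < n -> ~ critical (after k)].
Proof.
split=> [|[n [n0 -> nc]]].
  elim=> {s} [t|s t _ [n [n0 -> nc]] sc] /stabE <-.
    by exists 1; split=> // k; lia.
  exists n.+1; split=> // k /andP[k0]; rewrite ltnS leq_eqVlt => /orP[/eqP ->//|kn].
  by apply: nc; rewrite k0.
elim: n n0 nc => // -[|n] IHn _ nc.
  by apply: process_first; apply: stabP.
apply: (@process_next (after n.+1)); last exact: stabP; last first.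
  by apply: nc; rewrite /= ltnS.
by apply: IHn => // k /andP[k0 kn]; apply: nc; rewrite k0 ltnW.
Qed.

Lemma final_exists : exists s, final s.
Proof.
case: (ex_minnP after_critical) => n /andP[n0 /forallP nc] nmin.
exists (after n); split; last by move=> v; apply/eqP.
apply/process_after; exists n; split=> // k /andP[k0 kn] kc.
have : n <= k by apply: nmin; rewrite k0; apply/forallP=> v; apply/eqP.
by rewrite leqNgt kn.
Qed.

Lemma final_unique s t : final s -> final t -> s = t.
Proof.
move=> [/process_after[n [n0 -> nc]] sc] [/process_after[k [k0 -> kc]] tc].
have [lt_nk|lt_kn|-> //] := ltngtP n k.
  by case: (kc n); rewrite ?n0.
by case: (nc k); rewrite ?k0.
Qed.

Definition final_state : state :=
  proj1_sig (constructive_indefinite_description _ final_exists).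

Lemma final_stateP : final final_state.
Proof. exact: proj2_sig (constructive_indefinite_description _ final_exists). Qed.

Definition restoration_function (v : T) : nat := final_state (inr v).

Definition restoration_number : nat := restoration_function (tree_root T).

End Abacus.

Arguments restoration_function T v : clear implicits.
Arguments restoration_number T : clear implicits.

Definition period (T : rooted_tree) : nat :=
  restoration_number (root_join (fun _ : 'I_1 => T)).

(* Main.v *)
Require Import Defs.
From Stdlib Require Import Relation_Operators.
From mathcomp Require Import all_boot all_order all_algebra zify.
Import GRing.Theory.

Set Implicit Arguments.
Unset Strict Implicit.
Unset Printing Implicit Defensive.

(** Write [x v] for the number of chips in the absorbing vertex of [v], that is,
    for the number of times [v] has fired. When [n] chips have been added to the
    root [r], counting the chips that enter and leave [v] gives
    [s v + (deg v + 1) * x v = deg v + n * [v = r] + \sum_(w ~ v) x w],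
    so that at a critical state [x] solves the linear system
    [(deg v + 1) * x v = \sum_(w ~ v) x w + n * [v = r]]
    ([after_balance]). The equations at [v <> r] say that [x] is harmonic;
    summing all the equations shows that the one at the root then holds for
    [n = \sum_v x v] and for no other [n] ([harmonic_root]).

    Conversely every harmonic [x] in nonnegative integers is realized: after
    [\sum_v x v] chips the state is critical and [x] is the firing vector
    ([harmonic_realized]). No vertex can fire more than [x] prescribes, by
    induction along the firings, and then a count of all chips leaves no room
    for it to fire less. In particular harmonic vectors are determined by
    their sum, hence pairwise proportional, and since the restoration function
    is the one with the least positive sum, the harmonic vectors are exactly its
    multiples ([restoration_generates]).

    The theorem is now arithmetic. A vector on the tree that joins
    [T_1, ..., T_m] to a new root is harmonic exactly when its restriction to
    each [T_k] is harmonic, hence a multiple [c_k] of the restoration function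
    of [T_k], and the equation at the root of [T_k] holds; this last equation
    says that the value at the new root is [c_k * q_k], where [q_k] depends on
    [T_k] only ([harmonic_join]). The smallest positive common value of the [c_k * q_k]
    is [lcm (q_1, ..., q_m)], and the case of a single subtree shows that [q_k]
    is the period of [T_k]. *)

(** * Firing vectors and the balance of chips *)

Section Harmonic.

Variable T : rooted_tree.
Implicit Types (x y : T -> nat) (s t : state T) (v w : T) (n : nat).

Definition neighbor_sum x v := \sum_(w | tree_edge v w) x w.

Definition harmonic x :=
  forall v, v != tree_root T -> (deg v + 1) * x v = neighbor_sum x v.

Lemma degE v : deg v = \sum_(w | tree_edge v w) 1.
Proof. by rewrite sum1dep_card. Qed.

(** The effect of one firing of [v] on the neighbor sums of the firing vector. *)
Lemma neighbor_sum_indicator v w :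
  neighbor_sum (fun u => (u == v) : nat) w = aug_arc (inl v) (inl w).
Proof.
rewrite /neighbor_sum -big_mkcondr /= tree_edge_sym.
case: (boolP (tree_edge w v)) => wv; last first.
  by rewrite big1 // => u /andP[wu /eqP uv]; rewrite -uv wu in wv.
by rewrite (big_pred1 v) // => u /=; case: eqP => [->|]; rewrite ?wv ?andbF.
Qed.

(** The augmented Laplacian is symmetric with diagonal excess one, so each of its
    columns sums to [1]. *)
Lemma sum_neighbor_sum x :
  \sum_v (deg v + 1) * x v = \sum_v neighbor_sum x v + \sum_v x v.
Proof.
rewrite /neighbor_sum (exchange_big_dep predT) //= -big_split; apply: eq_bigr => v _ /=.
rewrite mulnDl mul1n degE big_distrl /=; congr (_ + _).
by apply: eq_big => w; rewrite ?mul1n // tree_edge_sym.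
Qed.

Lemma harmonic_root x : harmonic x -> forall v,
  (deg v + 1) * x v = neighbor_sum x v + (\sum_w x w) * (v == tree_root T).
Proof.
move=> hx v; have [->|vr] := eqVneq v (tree_root T); last first.
  by rewrite muln0 addn0 hx.
have := sum_neighbor_sum x.
rewrite (bigD1 (tree_root T)) //= (bigD1 (tree_root T) (F := neighbor_sum x)) //=.
by rewrite (eq_bigr (neighbor_sum x)) => [|w /hx //]; lia.
Qed.

(** Every firing of a vertex moves one chip into its absorbing vertex, so the absorbed chips
    record the firing vector; the equation weighs the chips lost and received by
    [v] since [n] chips were added to the critical loading. *)
Definition balanced n s := forall v,
  s (inl v) + (deg v + 1) * s (inr v) =
    deg v + n * (v == tree_root T) + neighbor_sum (fun w => s (inr w)) v.

Lemma balanced_fire n s v : balanced n s -> can_fire s v -> balanced n (fire s v).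
Proof.
rewrite /can_fire => bs sv w.
have -> : neighbor_sum (fun u => fire s v (inr u)) w =
    neighbor_sum (fun u => s (inr u)) w + aug_arc (inl v) (inl w).
  rewrite -neighbor_sum_indicator -big_split; apply: eq_bigr => u _ /=.
  by rewrite fireE /= subn0 eq_sym.
have := bs w; rewrite !fireE /=.
have [->|wv] := eqVneq w v.
  by rewrite eqxx tree_edge_irr subn0 !addn0 mulnDr muln1 addnCA subnK // addnC.
have -> : (inl w == inl v :> aug_vert T) = false.
  by apply/eqP => -[/eqP]; rewrite (negbTE wv).
by rewrite !subn0 addn0 => balance_w; rewrite addnAC addnA balance_w.
Qed.

(** The least action principle: the firing of [v] is legal only when the
    balance at [v] still requires it, so no firing sequence overshoots a solution
    of the system. *)
Lemma fire_le_harmonic x s v : harmonic x -> balanced (\sum_w x w) s ->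
    (forall w, s (inr w) <= x w) -> can_fire s v ->
  forall w, fire s v (inr w) <= x w.
Proof.
rewrite /can_fire => hx bs sx sv w; rewrite fireE /= subn0.
have [<-|_] := eqVneq v w; last by rewrite addn0.
have le_nb : neighbor_sum (fun w => s (inr w)) v <= neighbor_sum x v.
  exact: leq_sum.
rewrite addn1 ltn_neqAle sx andbT; apply/eqP => sxv.
have := bs v; rewrite sxv (harmonic_root hx); move: sv le_nb.
move: (s _) (deg v) (neighbor_sum _ v) (neighbor_sum x v) (_ * _); lia.
Qed.

Lemma stab_ind (P : state T -> Prop) s : P s ->
    (forall t v, P t -> can_fire t v -> P (fire t v)) ->
  P (stab s).
Proof.
move=> Ps Pfire; have [st _] := stabP s.
by elim: st Ps => // {}s t u [v sv ->] _ IH /Pfire/(_ sv).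
Qed.

Lemma start_absorbed n v : addst (initial T) (rchips T n) (inr v) = 0.
Proof. by rewrite !ffunE muln0. Qed.

Lemma start_balanced n : balanced n (addst (initial T) (rchips T n)).
Proof.
move=> v; rewrite start_absorbed muln0 addn0 [neighbor_sum _ _]big1 => [|w _].
  by rewrite !ffunE addn0.
exact: start_absorbed.
Qed.

Lemma after_balance n : balanced n (after T n).
Proof.
by rewrite afterE; apply: stab_ind (start_balanced n) _ => t v; apply: balanced_fire.
Qed.

Lemma balanced_sum n s : balanced n s ->
  \sum_v s (inl v) + \sum_v s (inr v) = \sum_(v : T) deg v + n.
Proof.
move=> bs.
have: \sum_v (s (inl v) + (deg v + 1) * s (inr v)) =
    \sum_v (deg v + n * (v == tree_root T) + neighbor_sum (fun w => s (inr w)) v).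
  by apply: eq_bigr => v _; exact: bs.
rewrite !big_split /= sum_neighbor_sum -big_distrr /= -big_mkcond /= big_pred1_eq.
lia.
Qed.

(** At the stable state that follows the addition of [\sum_v x v] chips,
    [absorbed <= x] and [s v <= deg v] everywhere, while the total number of
    chips forces equality in the sum of all these inequalities. *)
Lemma harmonic_realized x : harmonic x ->
  let s := after T (\sum_v x v) in critical s /\ forall v, s (inr v) = x v.
Proof.
move=> hx s.
have le_deg v : s (inl v) <= deg v.
  by have := @after_stable T (\sum_v x v) v; rewrite /can_fire -/s; lia.
have le_x v : s (inr v) <= x v.
  rewrite /s afterE.
  pose P t := balanced (\sum_v x v) t /\ forall w, t (inr w) <= x w.
  suff [] : P (stab (addst (initial T) (rchips T (\sum_v x v)))) by [].
  apply: stab_ind => [|t w [bt tx] tw].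
    by split=> [|w]; [exact: start_balanced | rewrite start_absorbed].
  by split; [exact: balanced_fire | exact: fire_le_harmonic].
have total := balanced_sum (after_balance (\sum_v x v)).
have le_sdeg := leqif_sum (fun v (_ : true) => leqif_eq (le_deg v)).
have le_sx := leqif_sum (fun v (_ : true) => leqif_eq (le_x v)).
have [eq_deg eq_x] : \sum_v s (inl v) == \sum_(v : T) deg v /\
    \sum_v s (inr v) == \sum_v x v.
  by move: total le_sdeg.1 le_sx.1; rewrite -/s; lia.
by split=> v; apply/eqP; [move: eq_deg v | move: eq_x v];
  rewrite ?le_sdeg ?le_sx => /forallP.
Qed.

(** Both sides are harmonic vectors with the sum [(\sum_w x w) * (\sum_w y w)], and
    this sum determines the abacus state that realizes them. *)
Lemma harmonic_proportional x y : harmonic x -> harmonic y ->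
  forall v, (\sum_w x w) * y v = (\sum_w y w) * x v.
Proof.
have scale c z : harmonic z -> harmonic (fun v => c * z v).
  by move=> hz v /hz; rewrite /neighbor_sum -big_distrr /=; nia.
move=> hx hy v.
have [_ <-] := harmonic_realized (scale (\sum_w x w) y hy).
have [_ <-] := harmonic_realized (scale (\sum_w y w) x hx).
by rewrite -!big_distrr /= mulnC.
Qed.

(** * The restoration function generates the harmonic vectors *)

Local Notation R := (restoration_function T).

Lemma restoration_first : exists2 n,
    0 < n /\ (forall k, 0 < k < n -> ~ critical (after T k)) &
  [/\ critical (after T n) & forall v, R v = after T n (inr v)].
Proof.
have [/process_after[n [n0 Es nc]] sc] := final_stateP T.
by exists n; [split | rewrite -Es; split].
Qed.

Lemma restoration_harmonic : harmonic R.
Proof.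
have [n _ [nc Rn]] := restoration_first => v vr.
have := after_balance n v; rewrite nc (negbTE vr) muln0 addn0 -Rn.
by rewrite /neighbor_sum (eq_bigr R) => [/addnI //|w _]; rewrite Rn.
Qed.

Lemma restoration_sum_first : 0 < \sum_v R v /\
  forall k, 0 < k < \sum_v R v -> ~ critical (after T k).
Proof.
have [n n_first [nc Rn]] := restoration_first.
suff -> : \sum_v R v = n by [].
have := balanced_sum (after_balance n); rewrite (eq_bigr _ (fun v _ => nc v)).
by rewrite (eq_bigr _ (fun v _ => Rn v)) => /addnI.
Qed.

(** Divide the number of chips [\sum_v x v] by [\sum_v R v]: the corresponding
    remainder of [x] modulo [R] is again harmonic, with a sum that is too
    small to be positive. *)
Theorem restoration_generates x : harmonic x ->
  exists c, forall v, x v = c * R v.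
Proof.
move=> hx; have [N0 N_first] := restoration_sum_first.
set N := \sum_v R v in N0 N_first; pose q := (\sum_v x v) %/ N.
have prop := harmonic_proportional hx restoration_harmonic.
have le_qR v : q * R v <= x v.
  have := prop v; rewrite -/N => E; rewrite -(leq_pmul2l N0) -E mulnA leq_mul2r.
  by rewrite mulnC leq_trunc_div orbT.
pose y v := x v - q * R v.
have xE v : x v = y v + q * R v by rewrite subnK.
have sum_y : \sum_v y v = (\sum_v x v) %% N.
  apply: (@addIn (q * N)); rewrite [RHS]addnC -divn_eq.
  by rewrite /N big_distrr -big_split /=; apply: eq_bigr => v _; exact/esym/xE.
have hy : harmonic y.
  move=> v vr; have := hx v vr; have := restoration_harmonic vr.
  have -> : neighbor_sum x v = neighbor_sum y v + q * neighbor_sum R v.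
    by rewrite /neighbor_sum big_distrr -big_split /=; apply: eq_bigr => w _; exact: xE.
  by rewrite xE; nia.
exists q => v; suff /eqP : \sum_v y v = 0.
  by rewrite sum_nat_eq0 => /forallP/(_ v)/= /eqP yv; rewrite xE yv.
apply/eqP; rewrite -leqn0 leqNgt; apply/negP => y0.
have [yc _] := harmonic_realized hy.
by case: (N_first _ _ yc); rewrite y0 sum_y ltn_mod.
Qed.

(** The value that the equation at the root of [T] forces upon the parent of that
    root, when [T] carries its restoration function. *)
Definition parent_value := \sum_v R v + R (tree_root T).

Lemma parent_value_gt0 : 0 < parent_value.
Proof. by rewrite addn_gt0 (restoration_sum_first).1. Qed.

End Harmonic.

(** * Joining trees at a new root *)

Section Joined.

Variables (m : nat) (T : 'I_m -> rooted_tree).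

Let T' := root_join T.

Lemma neighbor_sum_join (z : T' -> nat) k (v : T k) :
  neighbor_sum (T := T') z (in_join v) =
    neighbor_sum (fun w : T k => z (in_join w)) v +
    (v == tree_root (T k)) * z (tree_root T').
Proof.
pose pre (w : T') := [pick u : T k | in_join u == w].
have preK (u : T k) : pre (in_join u) = Some u.
  by rewrite /pre; case: pickP => [u' /eqP/in_join_inj-> //|/(_ u)]; rewrite eqxx.
rewrite /neighbor_sum big_mkcond (bigD1 (tree_root T')) //= addnC; congr (_ + _).
  rewrite -big_mkcondr (reindex_omap (@in_join m T k) pre) /= => [|w].
    apply: eq_bigl => u; rewrite preK /= !eqxx andbT.
    by rewrite tagged_asE.
  case: w => [[j u]|] //= /andP[/eqP/= ekj _]; case: j / ekj u => u.
  by rewrite (preK u).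
by case: eqP; rewrite ?mul1n ?mul0n.
Qed.

Lemma deg_join k (v : T k) :
  deg (T := T') (in_join v) = deg v + (v == tree_root (T k)).
Proof.
by rewrite !degE [LHS](neighbor_sum_join (fun=> 1)) muln1.
Qed.

(** At the root of [T_k] the equation in the join exceeds the one in [T_k] by one
    unit of degree on the left and by the value at the new root on the right,
    while within [T_k] the imbalance at the root is the sum of [z] over [T_k]. *)
Lemma harmonic_join (z : T' -> nat) : harmonic z <->
  forall k, let zk := fun w : T k => z (in_join w) in
    harmonic zk /\ z (tree_root T') = \sum_w zk w + zk (tree_root (T k)).
Proof.
split=> [hz k zk | hz [[k v]|] // _].
  have hzk : harmonic zk.
    move=> v vr; have /= := hz (in_join v) isT.
    by rewrite neighbor_sum_join deg_join (negbTE vr) mul0n !addn0.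
  split=> //; have /= := hz (in_join (tree_root (T k))) isT.
  rewrite neighbor_sum_join deg_join eqxx mul1n.
  by have := harmonic_root hzk (tree_root (T k)); rewrite eqxx /zk /=; nia.
have [hzk zr] := hz k.
change (Some _) with (in_join v); rewrite neighbor_sum_join deg_join zr.
have := harmonic_root hzk v; case: eqP => [->|_] /=; nia.
Qed.

Local Notation q k := (parent_value (T k)).
Local Notation L := (\big[lcmn/1]_(i < m) q i).

(** The lcm vector is harmonic, hence a multiple of the restoration function;
    conversely all the [q k] divide the value of the restoration function at the
    new root, so this multiple is by [1]. *)
Lemma restoration_join :
  restoration_function T' (tree_root T') = L /\
  forall k (w : T k), restoration_function T' (in_join w) =
    L %/ q k * restoration_function (T k) w.
Proof.
pose y (z : T') := if z is Some (existT k w)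
  then L %/ q k * restoration_function (T k) w else L.
have hy : harmonic y.
  apply/harmonic_join => k; split=> /= [v vr|].
    rewrite /neighbor_sum -big_distrr /= mulnCA.
    by rewrite (restoration_harmonic vr).
  by rewrite -big_distrr -mulnDr divnK // (biglcmn_sup k).
have [c yE] := restoration_generates hy.
have L_dvd : L %| restoration_function T' (tree_root T').
  apply/dvdn_biglcmP => k _.
  have [hk ->] := (harmonic_join _).1 (@restoration_harmonic T') k.
  have [d dE] := restoration_generates hk.
  by rewrite (eq_bigr _ (fun w _ => dE w)) dE -big_distrr -mulnDr dvdn_mull.
have L0 : 0 < L.
  apply: (big_ind (fun n => 0 < n)) => [//|a b a0 b0|k _]; last exact: parent_value_gt0.
  by rewrite lcmn_gt0 a0.
have c1 : c = 1.
  have LE : L = c * restoration_function T' (tree_root T') := yE (tree_root T').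
  move: L_dvd L0; rewrite LE muln_gt0 => dvd_r /andP[_ r0].
  by apply/eqP; rewrite -dvdn1 -(dvdn_pmul2r r0) mul1n.
have {c c1}yE z : restoration_function T' z = y z by rewrite yE c1 mul1n.
by split=> [|k w]; rewrite yE.
Qed.

End Joined.

Lemma period_parent_value (T : rooted_tree) : period T = parent_value T.
Proof.
by rewrite /period /restoration_number (restoration_join _).1 big_ord1.
Qed.

Local Open Scope ring_scope.

Theorem theorem3p5 (m : nat) (hm : (0 < m)%N) (T : 'I_m -> rooted_tree) :
  restoration_function (root_join T) (tree_root (root_join T)) =
    \big[lcmn/1%N]_(i < m) period (T i) /\
  (forall (k : 'I_m) (w : T k),
     (restoration_function (root_join T) (in_join w))%:R =
       (restoration_function (root_join T) (tree_root (root_join T)))%:R / (period (T k))%:R *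
       (restoration_function (T k) w)%:R :> rat).
Proof.
have [rootE childE] := restoration_join T.
have -> : restoration_function (root_join T) (tree_root (root_join T)) =
    \big[lcmn/1%N]_(i < m) period (T i).
  by rewrite rootE; apply: eq_bigr => i _; rewrite period_parent_value.
split=> // k w; rewrite childE natrM period_parent_value; congr (_ * _).
have p0 : (parent_value (T k))%:R != 0 :> rat.
  by rewrite Num.Theory.pnatr_eq0 -lt0n parent_value_gt0.
apply: (canRL (mulfK p0)); rewrite -natrM divnK; last exact: (biglcmn_sup k).
by congr (_%:R); apply: eq_bigr => i _; rewrite period_parent_value.
Qed.
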